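(* Fix $\varepsilon,\mu,\lambda>0$ and $\alpha\in[1,2]$, and consider the iterates generated for $k=0,1,2,\dots$ by $$u^{k+1}=F(x^k)+\vartheta_{k+1}\bigl(F(x^k)-F(x^{k-1})\bigr),\qquad x^{k+1}=\operatorname{prox}_{\gamma_{k+1}g}\bigl(x^k-\gamma_{k+1}u^{k+1}\bigr),$$ with $\gamma_k>0$, $\vartheta_{k+1}=\alpha\rho_{k+1}$ and $\rho_{k+1}=\frac{\gamma_{k+1}}{\gamma_k}$. For $x\in\operatorname{dom}g$ and $k\ge1$ let $$\mathcal U^\alpha_k(x):=\tfrac12\|x^k-x\|^2+\tfrac12\|\Delta_x^k\|^2+\tfrac{\lambda(\gamma_k\rho_k)^2}2\|\Delta_F^{k-1}\|^2+(1+\alpha\rho_k)\gamma_kV_{k-1}(x).$$ Then, for any $k\ge1$ and $x\in\operatorname{dom}g$, $$\mathcal U^\alpha_{k+1}(x)\le\mathcal U^\alpha_k(x)-\alpha\gamma_kA_{k+1}V_{k-1}(x)-(\alpha\rho_k\gamma_k)^2B_{k+1}\|\Delta_F^{k-1}\|^2-C_{k+1}\|\Delta_x^k\|^2,$$ where $$\begin{aligned} A_{k+1}&=\tfrac1\alpha+\rho_k-\rho_{k+1}^2,\\ B_{k+1}&=\tfrac{\lambda}{2\alpha^2}-\rho_{k+1}^2\Bigl(1+\tau_k\tfrac{2-\alpha}{2\alpha\varepsilon}+\tfrac{[\cos\phi_k]_-}{\mu}\Bigr),\\ C_{k+1}&=\tfrac12-(\gamma_{k+1}L_k)^2\Bigl(\tfrac\lambda2\rho_{k+1}^2+(1+\alpha\rho_{k+1})^2\bigl(1+\mu[\cos\phi_k]_-\bigr)\Bigr)+\Bigl(\alpha-1+2\gamma_k\ell_k-\tau_k\alpha\varepsilon\tfrac{2-\alpha}2\Bigr)\rho_{k+1}^2,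 \end{aligned}$$ with $$\tau_k:=\frac{\langle\Delta_x^k,\Delta_F^{k-1}\rangle}{\frac{\varepsilon}{2\gamma_k\rho_k}\|\Delta_x^k\|^2+\frac{\rho_k\gamma_k}{2\varepsilon}\|\Delta_F^{k-1}\|^2}\qquad\text{and}\qquad\cos\phi_k:=\frac{\langle\Delta_F^k,\Delta_F^{k-1}\rangle}{\|\Delta_F^k\|\|\Delta_F^{k-1}\|}$$ both bounded between $-1$ and $1$.
   Context: Standing assumptions: $F:\mathbb R^n\to\mathbb R^n$ is monotone and locally Lipschitz continuous; $g:\mathbb R^n\to\mathbb R\cup\{+\infty\}$ is proper, convex and lower semicontinuous; $\{x:0\in F(x)+\partial g(x)\}\neq\emptyset$. The initial points $x^{-1},x^0\in\mathbb R^n$ and $\gamma_0>0$ are given. $\operatorname{prox}_{\gamma g}(y)=\arg\min_z\{g(z)+\frac1{2\gamma}\|z-y\|^2\}$. Notation: $\Delta_x^k:=x^k-x^{k-1}$, $\Delta_F^k:=F(x^k)-F(x^{k-1})$; $[t]_-:=\max\{-t,0\}$; $L_k:=\|\Delta_F^k\|/\|\Delta_x^k\|$, $\ell_k:=\langle\Delta_F^k,\Delta_x^k\rangle/\|\Delta_x^k\|^2$; every quotient $\frac00$ is set to $0$; $V_k(x):=g(x^k)-g(x)-\langle F(x^k),x-x^k\rangle$. If $k=1$ and $x^0\notin\operatorname{dom}g$, then $V_0(x)=+\infty$ and the right-hand side of the inequality (in which $V_0(x)$ has total coefficient $\alpha\rho_2\gamma_2>0$) is understood as $+\infty$. *)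

(* Defs.v *)
From HB Require Import structures.
From mathcomp Require Import all_boot all_order all_algebra.
From mathcomp Require Import boolp classical_sets reals ereal topology normedtype.

Set Implicit Arguments.
Unset Strict Implicit.
Unset Printing Implicit Defensive.

Import Order.TTheory GRing.Theory Num.Theory numFieldNormedType.Exports.
Local Open Scope classical_set_scope.
Local Open Scope ring_scope.

(* R^n is 'rV[R]_n.  The library norm `|v| on row vectors is the sup norm,
   hence the separate Euclidean norm.  The topology is the library one. *)
Section Euclidean.
Context {R : realType} {n : nat}.
Implicit Types u v : 'rV[R]_n.

Definition dot u v : R := \sum_(i < n) u ord0 i * v ord0 i.

Definition enorm u : R := Num.sqrt (dot u u).

End Euclidean.

Section Problem.
Context {R : realType} {n : nat}.
Implicit Types (F : 'rV[R]_n -> 'rV[R]_n) (g : 'rV[R]_n -> \bar R).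
Implicit Types (x y z w v : 'rV[R]_n).

Definition monotone_map F := forall x y, 0 <= dot (F x - F y) (x - y).

Definition locally_lipschitz F := forall x,
  exists2 U, nbhs x U &
    exists L : R, forall y z, U y -> U z ->
      enorm (F y - F z) <= L * enorm (y - z).

Definition dom g : set 'rV[R]_n := [set x | (g x < +oo)%E].

(* Ruling out -oo everywhere makes g a function into R \cup {+oo}. *)
Definition proper_fun g := (forall x, g x != -oo%E) /\ (exists x, dom g x).

(* As 0 * +oo = 0 in \bar R, the endpoints t = 0, 1 impose nothing. *)
Definition convex_efun g := forall x y (t : R), 0 <= t <= 1 ->
  (g (t *: x + (1 - t) *: y)%R <= t%:E * g x + (1 - t)%:E * g y)%E.

Definition subdifferential g x : set 'rV[R]_n :=
  [set v | forall y, (g x + (dot v (y - x))%:E <= g y)%E].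

(* [set x | 0 \in F x + \partial g x] *)
Definition solutions F g : set 'rV[R]_n :=
  [set x | exists2 v, subdifferential g x v & 0 = F x + v].

(* The argmin set, which has at most one element for c > 0 and g proper and
   convex; z = prox_{c g}(y) is written prox c g y z. *)
Definition prox (c : R) g y : set 'rV[R]_n :=
  [set z | forall w, (g z + ((2 * c)^-1 * enorm (z - y) ^+ 2)%:E
                   <= g w + ((2 * c)^-1 * enorm (w - y) ^+ 2)%:E)%E].

End Problem.

Definition negpart {R : realType} (t : R) : R := Num.max (- t) 0.

(* Sequences are indexed by int because the iterates start at x^{-1}; their
   values at indices below -1 (below 0 for gamma) are never constrained.
   Quotients 0 / 0 are 0, as a / 0 = 0 in any field. *)
Section Iterates.
Context {R : realType} {n : nat}.
Variables (F : 'rV[R]_n -> 'rV[R]_n) (g : 'rV[R]_n -> \bar R).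
Variables (xs : int -> 'rV[R]_n) (gamma : int -> R).
Variables (alpha lambda epsilon mu : R).
Implicit Types (k : int) (x : 'rV[R]_n).

Definition Delta_x k : 'rV[R]_n := xs k - xs (k - 1).

Definition Delta_F k : 'rV[R]_n := F (xs k) - F (xs (k - 1)).

Definition rho k : R := gamma k / gamma (k - 1).

Definition theta k : R := alpha * rho k.

Definition generated_iterates := forall k, 0 <= k ->
  let u := F (xs k) + theta (k + 1) *: (F (xs k) - F (xs (k - 1))) in
  prox (gamma (k + 1)) g (xs k - gamma (k + 1) *: u) (xs (k + 1)).

Definition Lk k : R := enorm (Delta_F k) / enorm (Delta_x k).

Definition ellk k : R := dot (Delta_F k) (Delta_x k) / enorm (Delta_x k) ^+ 2.

Definition Vk k x : \bar R :=
  (g (xs k) - g x - (dot (F (xs k)) (x - xs k))%:E)%E.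

Definition Uk k x : \bar R :=
  ((2^-1 * enorm (xs k - x) ^+ 2
    + 2^-1 * enorm (Delta_x k) ^+ 2
    + lambda * (gamma k * rho k) ^+ 2 / 2 * enorm (Delta_F (k - 1)) ^+ 2)%:E
   + ((1 + alpha * rho k) * gamma k)%:E * Vk (k - 1)%R x)%E.

Definition tau k : R :=
  dot (Delta_x k) (Delta_F (k - 1)) /
  (epsilon / (2 * gamma k * rho k) * enorm (Delta_x k) ^+ 2
   + rho k * gamma k / (2 * epsilon) * enorm (Delta_F (k - 1)) ^+ 2).

Definition cosphi k : R :=
  dot (Delta_F k) (Delta_F (k - 1)) /
  (enorm (Delta_F k) * enorm (Delta_F (k - 1))).

(* Anext k, Bnext k, Cnext k are A_{k+1}, B_{k+1}, C_{k+1}. *)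
Definition Anext k : R := alpha^-1 + rho k - rho (k + 1) ^+ 2.

Definition Bnext k : R :=
  lambda / (2 * alpha ^+ 2)
  - rho (k + 1) ^+ 2 *
    (1 + tau k * ((2 - alpha) / (2 * alpha * epsilon))
       + negpart (cosphi k) / mu).

Definition Cnext k : R :=
  2^-1
  - (gamma (k + 1) * Lk k) ^+ 2 *
    (lambda / 2 * rho (k + 1) ^+ 2
     + (1 + alpha * rho (k + 1)) ^+ 2 * (1 + mu * negpart (cosphi k)))
  + (alpha - 1 + 2 * gamma k * ellk k
     - tau k * alpha * epsilon * ((2 - alpha) / 2)) * rho (k + 1) ^+ 2.

(* U_k - alpha gamma_k A_{k+1} V_{k-1}(x) - (alpha rho_k gamma_k)^2 B_{k+1}
   ||Delta_F^{k-1}||^2 - C_{k+1} ||Delta_x^k||^2, which is +oo if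
   V_{k-1}(x) = +oo.  The ordinary addition of \bar R yields -oo on
   (+oo) - (+oo), whereas the dual one (scope %dE) yields +oo; the two agree
   whenever V_{k-1}(x) is finite. *)
Definition descent_rhs k x : \bar R :=
  (Uk k x
   - (alpha * gamma k * Anext k)%:E * Vk (k - 1)%R x
   - ((alpha * rho k * gamma k) ^+ 2 * Bnext k
      * enorm (Delta_F (k - 1)) ^+ 2)%:E
   - (Cnext k * enorm (Delta_x k) ^+ 2)%:E)%dE.

End Iterates.

(* Main.v *)
(* The prox optimality conditions at steps k and k + 1 are tested at x, x^{k-1},
   x^k and x^{k+1}.  After adding them, the terms in x cancel exactly, and what
   remains is an estimate of <w, D'>, where D' = x^{k+1} - x^k and
     w = rho_{k+1} Delta_x^k + alpha rho_k gamma_k rho_{k+1} Delta_F^{k-1}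
         - (1 + alpha rho_{k+1}) gamma_{k+1} Delta_F^k.
   Monotonicity of the subdifferential gives |D'|^2 <= <w, D'>, hence
   <w, D'> <= |w|^2.  Expanding |w|^2, tau_k, l_k and L_k are exact renamings of
   the terms in which they occur, monotonicity of F absorbs the surplus of
   <Delta_F^k, Delta_x^k>, and Young's inequality with weight mu bounds
   <Delta_F^k, Delta_F^{k-1}>. *)

Require Import Defs.
From HB Require Import structures.
From mathcomp Require Import all_boot all_order all_algebra.
From mathcomp Require Import boolp classical_sets reals ereal topology normedtype.
From mathcomp Require Import ring lra.

Import Order.TTheory GRing.Theory Num.Theory numFieldNormedType.Exports.
Local Open Scope classical_set_scope.
Local Open Scope ring_scope.

(** * Euclidean inner product and norm *)

Section EuclideanTheory.
Context {R : realType} {n : nat}.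
Implicit Types (u v w : 'rV[R]_n) (a : R).

Lemma dotC u v : dot u v = dot v u.
Proof. by apply: eq_bigr => i _; rewrite mulrC. Qed.

Lemma dotDl u v w : dot (u + v) w = dot u w + dot v w.
Proof. by rewrite -big_split; apply: eq_bigr => i _; rewrite mxE mulrDl. Qed.

Lemma dotZl a u v : dot (a *: u) v = a * dot u v.
Proof. by rewrite mulr_sumr; apply: eq_bigr => i _; rewrite mxE mulrA. Qed.

Lemma dotNl u v : dot (- u) v = - dot u v.
Proof. by rewrite -scaleN1r dotZl mulN1r. Qed.

Lemma dotDr u v w : dot w (u + v) = dot w u + dot w v.
Proof. by rewrite dotC dotDl !(dotC w). Qed.

Lemma dotZr a u v : dot v (a *: u) = a * dot v u.
Proof. by rewrite dotC dotZl dotC. Qed.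

Lemma dotNr u v : dot v (- u) = - dot v u.
Proof. by rewrite dotC dotNl dotC. Qed.

Definition dotE := (dotDl, dotDr, dotNl, dotNr, dotZl, dotZr).

Lemma dot_ge0 u : 0 <= dot u u.
Proof. by apply: sumr_ge0 => i _; rewrite -expr2 sqr_ge0. Qed.

Lemma dot_eq0 u : (dot u u == 0) = (u == 0).
Proof.
apply/eqP/eqP => [u0|->]; last by rewrite -(scale0r 0) dotZl mul0r.
apply/rowP => i; rewrite mxE; apply/eqP; rewrite -sqrf_eq0 expr2.
by rewrite (psumr_eq0P _ u0) // => j _; rewrite -expr2 sqr_ge0.
Qed.

Lemma enorm_ge0 u : 0 <= enorm u.
Proof. exact: sqrtr_ge0. Qed.

Lemma enorm_sqr u : enorm u ^+ 2 = dot u u.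
Proof. by rewrite sqr_sqrtr// dot_ge0. Qed.

Lemma enorm_eq0 u : (enorm u == 0) = (u == 0).
Proof. by rewrite -sqrf_eq0 enorm_sqr dot_eq0. Qed.

(** Expand |<v,v> u - <u,v> v|^2 >= 0 and cancel one factor <v,v>. *)
Lemma Cauchy_Schwarz_dot u v : `|dot u v| <= enorm u * enorm v.
Proof.
rewrite -ler_sqr ?nnegrE ?mulr_ge0 ?enorm_ge0// exprMn !enorm_sqr.
rewrite real_normK ?num_real//.
have [->|v0] := eqVneq v 0; first by rewrite -(scale0r 0) !dotZr; lra.
have vv : 0 < dot v v by rewrite lt_def dot_eq0 v0 dot_ge0.
have := dot_ge0 (dot v v *: u - dot u v *: v).
rewrite !dotE (dotC v u) => h.
rewrite -subr_ge0 -(pmulr_rge0 _ vv); apply: le_trans h _.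
by rewrite le_eqVlt; apply/orP; left; apply/eqP; ring.
Qed.

(** Expand the squares of u + a v and u - a v. With a = rho_k gamma_k / epsilon the right-hand side
    is the denominator of [tau]. *)
Lemma normr_dot_le_weighted a u v : 0 < a ->
  `|dot u v| <= (2 * a)^-1 * dot u u + a / 2 * dot v v.
Proof.
move=> a0; have a'0 : a != 0 by rewrite gt_eqF.
have E (s : R) : s ^+ 2 = 1 ->
  (2 * a)^-1 * dot u u + a / 2 * dot v v + s * dot u v
  = (2 * a)^-1 * dot (u + (s * a) *: v) (u + (s * a) *: v).
  move=> s1; rewrite !dotE (dotC v u).
  rewrite (_ : a / 2 * dot v v = s ^+ 2 * (a / 2 * dot v v)); first by field.
  by rewrite s1 mul1r.
have P (s : R) : s ^+ 2 = 1 ->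
  0 <= (2 * a)^-1 * dot u u + a / 2 * dot v v + s * dot u v.
  by move=> /E ->; rewrite mulr_ge0 ?dot_ge0// invr_ge0; lra.
have P1 := P 1 (expr1n _ _).
have P2 : 0 <= _ := P (-1) (etrans (sqrrN 1) (expr1n _ _)).
by rewrite ler_norml; apply/andP; split; lra.
Qed.

(** Since |v|^2 <= <u,v>, one has 0 <= |u - v|^2 <= |u|^2 - <u,v>. *)
Lemma dot_le_of_firm u v : 0 <= dot (u - v) v -> dot u v <= dot u u.
Proof. by have := dot_ge0 (u - v); rewrite !dotE (dotC v u); lra. Qed.

End EuclideanTheory.

(** * Quotients and small multiples in a real field *)

Lemma normr_div_le1 {K : realFieldType} (a b : K) : `|a| <= b -> -1 <= a / b <= 1.
Proof.
move=> ab; have b0 : 0 <= b := le_trans (normr_ge0 _) ab.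
rewrite -ler_norml normrM normfV (ger0_norm b0).
have [->|bn0] := eqVneq b 0; first by rewrite invr0 mulr0.
by rewrite ler_pdivrMr ?mul1r// lt_def bn0.
Qed.

(* At b = 0 the bound forces a = 0, matching the convention 0 / 0 = 0. *)
Lemma divfK_normr {K : realFieldType} (a b : K) : `|a| <= b -> a / b * b = a.
Proof.
have [->|bn0] := eqVneq b 0; last by rewrite divfK.
by rewrite normr_le0 => /eqP->; rewrite mulr0.
Qed.

(** Stands in for the limit t -> 0: if e > 0, the choice t = e / (e + M) yields e^2 <= 0. *)
Lemma le0_of_small_multiples {K : realFieldType} (e M : K) : 0 <= M ->
  (forall t, 0 < t <= 1 -> e <= t * M) -> e <= 0.
Proof.
move=> M0 h; rewrite leNgt; apply/negP => e0.
have eM : 0 < e + M by lra.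
have /h : 0 < e / (e + M) <= 1 by rewrite divr_gt0//= ler_pdivrMr//; lra.
by rewrite mulrAC ler_pdivlMr//; nra.
Qed.

(** * Optimality conditions for proximal points *)

Section Prox.
Context {R : realType} {n : nat}.
Variable g : 'rV[R]_n -> \bar R.
Hypothesis g_proper : proper_fun g.

Lemma proper_dom_fin_num x : dom g x -> g x \is a fin_num.
Proof. by move=> gx; rewrite fin_numE g_proper.1 lt_eqF. Qed.

Lemma prox_dom c y z : prox c g y z -> dom g z.
Proof.
move=> zP; have [w gw] := g_proper.2; have := zP w.
rewrite -(fineK (proper_dom_fin_num _ gw)) /dom /=.
by case: (g z) => [r _| |] //; exact: ltry.
Qed.

(** Compare z with z + t (w - z) and use convexity. After division by t the quadratic remainder is t
    |w - z|^2 / (2c), which vanishes with t. *)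
Lemma prox_subdifferential c y z : convex_efun g -> 0 < c ->
  prox c g y z -> subdifferential g z (c^-1 *: (y - z)).
Proof.
move=> g_convex c0 zP w.
have [gw|] := boolP (g w < +oo)%E; last first.
  by rewrite -leNgt leye_eq => /eqP ->; rewrite leey.
have := proper_dom_fin_num _ (prox_dom _ _ _ zP).
have := proper_dom_fin_num _ gw.
case gzE : (g z) => [a| |]//; case gwE : (g w) => [b| |]// _ _.
rewrite -EFinD lee_fin -subr_le0.
apply: (@le0_of_small_multiples _ _ ((2 * c)^-1 * dot (w - z) (w - z))).
  by rewrite mulr_ge0 ?dot_ge0// invr_ge0; lra.
move=> t /andP[t0 t1].
have t01 : 0 <= t <= 1 by rewrite ltW.
have := g_convex w z t t01; have := zP (t *: w + (1 - t) *: z).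
rewrite gzE gwE -!EFinM -EFinD.
have : t *: w + (1 - t) *: z = z + t *: (w - z).
  by apply/rowP => i; rewrite !mxE; ring.
move=> -> /le_trans h
  /(leeD2r ((2 * c)^-1 * enorm (z + t *: (w - z) - y) ^+ 2)%:E) /h.
rewrite -!EFinD lee_fin !enorm_sqr.
rewrite (_ : z + t *: (w - z) - y = (z - y) + t *: (w - z)); last first.
  by rewrite addrAC.
rewrite -(opprB z y); move: (z - y) (w - z) => p q.
rewrite !dotE (dotC q p) => h'.
rewrite -(ler_pM2l t0) -subr_ge0; move: h'; rewrite -subr_ge0; congr (0 <= _).
by field; rewrite gt_eqF.
Qed.

Lemma prox_le c y z w : convex_efun g -> 0 < c -> prox c g y z -> dom g w ->
  c * (fine (g z) - fine (g w)) <= dot (y - z) (z - w).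
Proof.
move=> g_convex c0 zP gw.
have := prox_subdifferential _ _ _ g_convex c0 zP w.
rewrite -(fineK (proper_dom_fin_num _ (prox_dom _ _ _ zP))).
rewrite -(fineK (proper_dom_fin_num _ gw)) -EFinD lee_fin dotZl.
rewrite -(ler_pM2l c0) mulrDr mulVKf ?gt_eqF//.
by rewrite -(opprB z w) dotNr /=; lra.
Qed.

End Prox.

(** * The one-step estimate, free of sequences and infinite values *)

Section Descent.
Context {R : realType} {n : nat}.
Implicit Types D E H : 'rV[R]_n.

(** By Cauchy-Schwarz, cosine times norms gives back the inner product even if a norm vanishes. *)
Lemma neg_dot_le_cos E H :
  - dot E H <= negpart (dot E H / (enorm E * enorm H)) * (enorm E * enorm H).
Proof.
have CS := Cauchy_Schwarz_dot E H.
rewrite -{1}(divfK_normr _ _ CS) -mulNr ler_wpM2r ?mulr_ge0 ?enorm_ge0//.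
by rewrite le_max lexx.
Qed.

Lemma increment_bound (p a b c mu : R) D D' E H :
  0 <= a -> 0 <= b -> 0 <= c -> 0 < mu ->
  - dot E H <= c * (enorm E * enorm H) ->
  0 <= dot (p *: D + a *: H - b *: E - D') D' ->
  dot (p *: D + a *: H - b *: E) D' <=
    p ^+ 2 * dot D D + a ^+ 2 * (1 + c / mu) * dot H H
    + b ^+ 2 * (1 + mu * c) * dot E E
    + 2 * p * a * dot D H - 2 * p * b * dot E D.
Proof.
move=> a0 b0 c0 mu0 EH /dot_le_of_firm/le_trans; apply.
have young : 2 * (a * b) * - dot E H <=
    a ^+ 2 * (c / mu) * dot H H + b ^+ 2 * (mu * c) * dot E E.
  apply: (@le_trans _ _ (2 * (a * b) * (c * (enorm E * enorm H)))).
    by rewrite ler_wpM2l// !mulr_ge0.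
  rewrite -!enorm_sqr -subr_ge0.
  (* Young's inequality with weight mu, as a completed square. *)
  suff -> : a ^+ 2 * (c / mu) * enorm H ^+ 2 + b ^+ 2 * (mu * c) * enorm E ^+ 2
      - 2 * (a * b) * (c * (enorm E * enorm H))
      = c / mu * (a * enorm H - mu * b * enorm E) ^+ 2.
    by rewrite mulr_ge0 ?sqr_ge0// divr_ge0// ltW.
  by field; rewrite gt_eqF.
rewrite !dotE (dotC H D) (dotC H E) (dotC D E); lra.
Qed.

(** Dictionary: s = gamma_k, r = rho_k, r' = rho_{k+1}, c = [cos phi_k]_-, y = x^k - x, D and D' are
    Delta_x^k and Delta_x^{k+1}, E and H are Delta_F^k and Delta_F^{k-1}, f = F(x^k); [gm], [g0],
    [gp], [gx] are the values of g at x^{k-1}, x^k, x^{k+1}, x. The vectors [v], [v'] are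
    subgradients at x^k, x^{k+1} scaled by their step sizes. *)
Lemma prox_descent (alpha s r r' c mu gx gm g0 gp : R) y D D' E H f :
  0 <= alpha -> 0 < s -> 0 < r -> 0 < r' -> 0 <= c -> 0 < mu ->
  - dot E H <= c * (enorm E * enorm H) -> 0 <= dot E D ->
  let v := - D - s *: (f - E + (alpha * r) *: H) in
  let v' := - D' - (r' * s) *: (f + (alpha * r') *: E) in
  s * (g0 - gm) <= dot v D ->
  s * (g0 - gp) <= dot v (- D') ->
  r' * s * (gp - g0) <= dot v' D' ->
  r' * s * (gp - gx) <= dot v' (D' + y) ->
  2^-1 * dot (D' + y) (D' + y) + 2^-1 * dot D' D'
    + (1 + alpha * r') * (r' * s) * (g0 - gx + dot f y) <=
  2^-1 * dot y y + alpha * r' ^+ 2 * s * (gm - gx + dot (f - E) (y - D))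
    + (alpha * r * s * r') ^+ 2 * (1 + c / mu) * dot H H
    + ((1 + alpha * r') * (r' * s)) ^+ 2 * (1 + mu * c) * dot E E
    + alpha * (2 - alpha) * r' ^+ 2 * r * s * dot D H
    - (alpha - 1) * r' ^+ 2 * dot D D - 2 * s * r' ^+ 2 * dot E D.
Proof.
move=> al0 s0 r0 r'0 c0 mu0 EH ED v v' gmP g0P gpP gxP.
have a0 : 0 <= alpha * r * s * r' by rewrite !mulr_ge0// ltW.
have b0 : 0 <= (1 + alpha * r') * (r' * s).
  by rewrite mulr_ge0 ?addr_ge0// mulr_ge0// ltW.
(* The vector on the left is v' - r' v: adding r' times [g0P] to [gpP] cancels the values of g and
   the terms in f. *)
have /(increment_bound _ _ _ _ _ _ _ _ _ a0 b0 c0 mu0 EH) :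
    0 <= dot (r' *: D + (alpha * r * s * r') *: H
              - ((1 + alpha * r') * (r' * s)) *: E - D') D'.
  have := ler_wpM2l (ltW r'0) g0P; move: gpP.
  by rewrite /v /v' !dotE; lra.
(* Expanding |w|^2 leaves -2 alpha r'^3 s <E,D>, absent from the target and nonpositive. *)
have {}ED : 0 <= alpha * r' ^+ 2 * (r' * s) * dot E D.
  by rewrite mulr_ge0// !mulr_ge0// ?sqr_ge0// ltW.
(* The weights r', alpha r'^2 and 1 on [g0P], [gmP] and [gxP] produce exactly the values of g in the
   conclusion. *)
have := ler_wpM2l (ltW r'0) g0P.
have ar0 : 0 <= alpha * r' ^+ 2 by rewrite mulr_ge0 ?sqr_ge0.
have := ler_wpM2l ar0 gmP; move: gxP; clear gmP g0P gpP ar0 EH a0 b0.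
rewrite /v /v' !dotE.
rewrite ?(dotC D' y) ?(dotC D' D) ?(dotC H D) ?(dotC H D') ?(dotC D' E).
rewrite ?(dotC D E) ?(dotC f D) ?(dotC f D') ?(dotC f y) ?(dotC E y).
rewrite ?(dotC D y); lra.
Qed.

End Descent.

(** * Transfer of the estimate to the iterates *)

Theorem theorem3p1 (R : realType) (n : nat)
    (F : 'rV[R]_n -> 'rV[R]_n) (g : 'rV[R]_n -> \bar R)
    (F_monotone : monotone_map F) (F_lipschitz : locally_lipschitz F)
    (g_proper : proper_fun g) (g_convex : convex_efun g)
    (g_lsc : lower_semicontinuous g)
    (solvable : solutions F g !=set0)
    (epsilon mu lambda alpha : R)
    (epsilon_gt0 : 0 < epsilon) (mu_gt0 : 0 < mu) (lambda_gt0 : 0 < lambda)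
    (alpha12 : 1 <= alpha <= 2)
    (xs : int -> 'rV[R]_n) (gamma : int -> R)
    (gamma_gt0 : forall k : int, 0 <= k -> 0 < gamma k)
    (xs_iterates : generated_iterates F g xs gamma alpha) :
  forall k : int, 1 <= k ->
    (forall x : 'rV[R]_n, dom g x ->
       (Uk F g xs gamma alpha lambda (k + 1)%R x
        <= descent_rhs F g xs gamma alpha lambda epsilon mu k x)%E)
    /\ -1 <= tau F xs gamma epsilon k <= 1
    /\ -1 <= cosphi F xs k <= 1.
Proof.
move=> k k1.
have [/andP[al1 al2] k0 km0] : [/\ 1 <= alpha <= 2, 0 <= k & 0 <= k - 1].
  by split=> //; [exact: le_trans k1|rewrite subr_ge0].
have al0 : 0 < alpha by lra.
have := gamma_gt0 _ km0; have s0 := gamma_gt0 _ k0.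
have := gamma_gt0 (k + 1) (addr_ge0 k0 ler01) => s'0 sm0.
have r0 : 0 < rho gamma k by rewrite divr_gt0.
have r'0 : 0 < rho gamma (k + 1) by rewrite divr_gt0// addrK.
have s'E : gamma (k + 1) = rho gamma (k + 1) * gamma k.
  by rewrite /rho addrK divfK// gt_eqF.
have cosP := Cauchy_Schwarz_dot (Delta_F F xs k) (Delta_F F xs (k - 1)).
have tauP : `|dot (Delta_x xs k) (Delta_F F xs (k - 1))| <=
    epsilon / (2 * gamma k * rho gamma k) * enorm (Delta_x xs k) ^+ 2
    + rho gamma k * gamma k / (2 * epsilon) * enorm (Delta_F F xs (k - 1)) ^+ 2.
  have a0 : 0 < rho gamma k * gamma k / epsilon by rewrite divr_gt0// mulr_gt0.
  apply: le_trans (normr_dot_le_weighted _ _ _ a0) _.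
  rewrite !enorm_sqr le_eqVlt; apply/orP; left; apply/eqP.
  by field; rewrite !gt_eqF.
split; last by split; exact: normr_div_le1.
move=> x gx.
have gxE := fineK (proper_dom_fin_num _ g_proper _ gx).
have Pp := xs_iterates _ k0.
have P0 := xs_iterates _ km0; rewrite /= subrK in P0.
have gp := prox_dom _ g_proper _ _ _ Pp.
have g0 := prox_dom _ g_proper _ _ _ P0.
have gpE := fineK (proper_dom_fin_num _ g_proper _ gp).
have g0E := fineK (proper_dom_fin_num _ g_proper _ g0).
(* Only x^0 can lie outside dom g, as later iterates are proximal points. Then V_{k-1}(x) = +oo has
   a positive coefficient in U_k, and dual addition keeps the right-hand side at +oo. *)
have [gm|] := boolP (g (xs (k - 1)%R) < +oo)%E; last first.
  rewrite -leNgt leye_eq => /eqP gm.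
  have V : Vk F g xs (k - 1) x = +oo%E by rewrite /Vk gm -gxE.
  rewrite /descent_rhs /Uk V gt0_muley; last first.
    by rewrite lte_fin mulr_gt0// addr_gt0// mulr_gt0.
  by rewrite addey//; exact: leey.
have gmE := fineK (proper_dom_fin_num _ g_proper _ gm).
have [Lipsq ellE] : Lk F xs k ^+ 2 * dot (Delta_x xs k) (Delta_x xs k)
      = dot (Delta_F F xs k) (Delta_F F xs k)
    /\ ellk F xs k * dot (Delta_x xs k) (Delta_x xs k)
      = dot (Delta_F F xs k) (Delta_x xs k).
  rewrite /Lk /ellk -(enorm_sqr (Delta_x xs k)) -exprMn -enorm_sqr.
  (* If Delta_x^k = 0, then Delta_F^k = 0 too, so both identities survive the convention 0/0 = 0. *)
  have [|D0] := boolP (enorm (Delta_x xs k) == 0).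
    rewrite enorm_eq0 subr_eq0 => /eqP xE.
    have -> : Delta_F F xs k = 0 by rewrite /Delta_F xE subrr.
    have e0 : enorm (0 : 'rV[R]_n) = 0 by apply/eqP; rewrite enorm_eq0.
    have d0 (v : 'rV[R]_n) : dot 0 v = 0 by rewrite -(scale0r 0) dotZl mul0r.
    by rewrite e0 d0 !mul0r.
  by rewrite !divfK// sqrf_eq0.
have V0E : Vk F g xs (k - 1)%R x = (fine (g (xs (k - 1)%R)) - fine (g x)
    + dot (F (xs k) - Delta_F F xs k) (xs k - x - Delta_x xs k))%:E.
  rewrite /Vk -gmE -gxE -!EFinB /Delta_F /Delta_x subKr.
  have -> : xs k - x - (xs k - xs (k - 1)) = - (x - xs (k - 1)).
    by apply/rowP => i; rewrite !mxE; ring.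
  by rewrite dotNr.
have V1E : Vk F g xs (k + 1 - 1)%R x =
    (fine (g (xs k)) - fine (g x) + dot (F (xs k)) (xs k - x))%:E.
  by rewrite addrK /Vk -g0E -gxE -!EFinB -(opprB (xs k) x) dotNr opprK.
(* Used at w = x^k and w = x; its counterpart [step0] at w = x^{k-1} and w = x^{k+1}. *)
have stepP w : dom g w ->
    rho gamma (k + 1) * gamma k * (fine (g (xs (k + 1))) - fine (g w)) <=
    dot (- (xs (k + 1) - xs k) - (rho gamma (k + 1) * gamma k) *:
      (F (xs k) + (alpha * rho gamma (k + 1)) *: Delta_F F xs k))
      (xs (k + 1) - xs k + (xs k - w)).
  move=> gw; have := prox_le _ g_proper _ _ _ _ g_convex s'0 Pp gw.
  by rewrite s'E addrA subrK opprB -addrA (addrC (- (_ *: _))) addrA.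
have step0 w : dom g w -> gamma k * (fine (g (xs k)) - fine (g w)) <=
    dot (- Delta_x xs k - gamma k *: (F (xs k) - Delta_F F xs k
      + (alpha * rho gamma k) *: Delta_F F xs (k - 1))) (xs k - w).
  move=> gw; have := prox_le _ g_proper _ _ _ _ g_convex s0 P0 gw.
  by rewrite /Delta_x /Delta_F subKr opprB -addrA (addrC (- (_ *: _))) addrA.
have c0 : 0 <= negpart (cosphi F xs k) by rewrite le_max lexx orbT.
have gpP := step0 _ gp; rewrite -(opprB (xs (k + 1)) (xs k)) in gpP.
have g0P := stepP _ g0; rewrite subrr addr0 in g0P.
have := prox_descent _ _ _ _ _ _ _ _ _ _ (xs k - x) _ _ _ _ _
  (ltW al0) s0 r0 r'0 c0 mu_gt0 (neg_dot_le_cos _ _)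
  (F_monotone (xs k) (xs (k - 1))) (step0 _ gm) gpP g0P (stepP _ gx).
rewrite /descent_rhs /Uk V0E V1E -!EFinM -!EFinD.
rewrite -!DualAddTheoryNumDomain.dEFinB lee_fin.
have -> : Delta_x xs (k + 1) = xs (k + 1) - xs k by rewrite /Delta_x addrK.
have -> : xs (k + 1) - x = xs (k + 1) - xs k + (xs k - x) by rewrite addrA subrK.
rewrite addrK /Anext /Bnext /Cnext s'E !enorm_sqr.
rewrite -/(Delta_F F xs k) -/(Delta_x xs k).
have tauE : tau F xs gamma epsilon k * _ = _ := divfK_normr _ _ tauP.
rewrite -ellE -tauE -Lipsq !enorm_sqr -/(cosphi F xs k).
clear - al0 s0 r0 r'0 mu_gt0 epsilon_gt0.
(* What remains is an identity: the lambda terms of U_k and U_{k+1} cancel against those in B and C,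
   and V_{k-1}(x) keeps the coefficient alpha gamma_k rho_{k+1}^2. *)
move: (negpart _) (tau _ _ _ _ _) (Lk _ _ _) (ellk _ _ _) (rho gamma k)
  (rho gamma (k + 1)) (gamma k) r0 r'0 s0 => c t L l r r' s r0 r'0 s0.
move=> core; rewrite -subr_ge0 in core; rewrite -subr_ge0.
apply: le_trans core _; rewrite le_eqVlt; apply/orP; left; apply/eqP.
by field; rewrite !gt_eqF.
Qed.
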